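(* Let $G$ be a finite subgroup of $\mathrm{SO}(4)$. Then $G$ has an irreducible complex representation of odd dimension greater than $1$ if and only if $G$ has an irreducible complex representation of dimension $3$.
   Context: $\mathrm{SO}(4)$ denotes the real special orthogonal group of $4\times 4$ matrices. Representations are finite-dimensional over $\mathbb{C}$. *)

(* Defs.v *)
From HB Require Import structures.
From mathcomp Require Import all_boot all_order all_algebra.
From mathcomp Require Import all_fingroup all_character.
From mathcomp Require Import finmap complex reals.

Set Implicit Arguments.
Unset Strict Implicit.
Unset Printing Implicit Defensive.

Import GRing.Theory.

Section SpecialOrthogonal.
Context {R : comNzRingType} {n : nat}.
Local Open Scope ring_scope.

Definition special_orthogonal : pred 'M[R]_n :=
  fun A => (A *m A^T == 1%:M) && (\det A == 1).

Lemma special_orthogonal1 : special_orthogonal 1%:M.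
Proof. by rewrite /special_orthogonal trmx1 mulmx1 det1 !eqxx. Qed.

Lemma special_orthogonalM A B :
  special_orthogonal A -> special_orthogonal B -> special_orthogonal (A *m B).
Proof.
move=> /andP[/eqP oA /eqP dA] /andP[/eqP oB /eqP dB].
apply/andP; rewrite trmx_mul mulmxA -(mulmxA A) oB mulmx1 oA.
by rewrite det_mulmx dA dB mulr1 !eqxx.
Qed.

Lemma special_orthogonalV A :
  special_orthogonal A -> special_orthogonal A^T.
Proof.
move=> /andP[/eqP oA /eqP dA]; apply/andP.
by rewrite trmxK det_tr dA (mulmx1C oA) !eqxx.
Qed.
End SpecialOrthogonal.

Record SO (R : comNzRingType) (n : nat) : Type :=
  MkSO { SO_val :> 'M[R]_n; SO_valP : special_orthogonal SO_val }.

HB.instance Definition _ (R : comNzRingType) (n : nat) :=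
  [isSub for @SO_val R n].
HB.instance Definition _ (R : comNzRingType) (n : nat) :=
  [Choice of SO R n by <:].

Section SOGroup.
Variables (R : comNzRingType) (n : nat).
Implicit Types A B C : SO R n.

Definition SO_one : SO R n := MkSO special_orthogonal1.
Definition SO_mul A B : SO R n :=
  MkSO (special_orthogonalM (SO_valP A) (SO_valP B)).
Definition SO_inv A : SO R n := MkSO (special_orthogonalV (SO_valP A)).

Lemma SO_mulA : associative SO_mul.
Proof. by move=> A B C; apply/val_inj; exact: mulmxA. Qed.
Lemma SO_mul1 : left_id SO_one SO_mul.
Proof. by move=> A; apply/val_inj; exact: mul1mx. Qed.
Lemma SO_mulr1 : right_id SO_one SO_mul.
Proof. by move=> A; apply/val_inj; exact: mulmx1. Qed.
Lemma SO_mulrV : right_inverse SO_one SO_inv SO_mul.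
Proof. by move=> A; apply/val_inj; case/andP: (SO_valP A) => /eqP. Qed.
Lemma SO_mulV : left_inverse SO_one SO_inv SO_mul.
Proof.
by move=> A; apply/val_inj/mulmx1C; case/andP: (SO_valP A) => /eqP.
Qed.

HB.instance Definition _ :=
  isGroup.Build (SO R n) SO_mulA SO_mul1 SO_mulr1 SO_mulV SO_mulrV.
End SOGroup.

(* The ambient group may be infinite, so {group _} is not available. *)
Record finSubgroup (T : groupType) : Type := FinSubgroup {
  fsg_val :> {fset T};
  fsg_closed : group_closed (mem fsg_val)
}.

Definition fsg_type (T : groupType) (G : finSubgroup T) : Type :=
  fset_sub_type (fsg_val G).

HB.instance Definition _ (T : groupType) (G : finSubgroup T) :=
  SubFinite.on (fsg_type G).
HB.instance Definition _ (T : groupType) (G : finSubgroup T) :=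
  SubChoice_isSubGroup.Build T (mem (fsg_val G)) (fsg_type G) (fsg_closed G).

(* G as a group of its own, i.e. the full group of the finGroupType fsg_type G;
   this is the form mx_representation expects. *)
Definition fsg_group (T : groupType) (G : finSubgroup T)
    : {group fsg_type G} := [set: fsg_type G]%G.

(* Main.v *)
From HB Require Import structures.
Require Import Defs.
From mathcomp Require Import all_boot all_order all_algebra.
From mathcomp Require Import all_fingroup all_solvable all_character.
From mathcomp Require Import finmap complex reals.
From mathcomp Require Import ring boolp.

Set Implicit Arguments.
Unset Strict Implicit.
Unset Printing Implicit Defensive.
Import Order.TTheory GRing.Theory Num.Theory.
Local Open Scope ring_scope.

(** The double cover of SO(4) by pairs of unit quaternions gives two
homomorphisms from SO(4) to SO(3), hence two 3-dimensional representations of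
G. Concretely, the skew-symmetric 4 x 4 matrices split into two 3-dimensional
spaces, the imaginary parts of two commuting quaternion algebras ([isoclinic],
with a boolean choosing the algebra), and conjugation by SO(4) preserves each
of them ([conj_isoclinic]). If one of these two representations ([iso_repr])
is irreducible over the complex numbers, it is the representation sought.

Suppose that both are reducible. A reducible representation of dimension 3 has
an invariant line, and here the line can be taken real
([reducible_iso_repr_real]). It is spanned by an imaginary quaternion, which
every element of G fixes up to sign, because conjugation preserves its square.
This gives nonzero imaginary quaternions X and Y, one in each algebra, such
that every g in G commutes or anticommutes with X, and likewise with Y. The
elements of G commuting with X form a subgroup K of index at most 2, and those
of K commuting with Y form a subgroup H of index at most 2 in K. The matrices
commuting with X and Y are the polynomials in X and Y
([centralizer_isoclinic_pair]), so H is abelian.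

Finally, an irreducible representation of odd degree stays irreducible on a
subgroup of index 2, since it could only break into two halves
([odd_irr_restrict]). Restricting from G to K and then to H shows that every
irreducible representation of G of odd degree has degree 1. *)

(** * Representations of odd degree and of degree 3 *)

(** The hypothesis on products says that K has index at most 2. For a proper
nonzero K-submodule U and t outside K, both U + Ut and their intersection are
G-submodules, so that the whole space is the direct sum of U and Ut, and its
dimension is even. *)
Lemma odd_irr_restrict (F : fieldType) (gT : finGroupType) (G K : {group gT})
    (sKG : K \subset G) n (rG : mx_representation F G n) :
  {in G :\: K &, forall x y, (x * y)%g \in K} -> odd n ->
  mx_irreducible rG -> mx_irreducible (subg_repr rG sKG).
Proof.
move=> mulGK odd_n /mx_irrP[n_gt0 irrG]; apply/mx_irrP; split=> // U modU nzU.
case: (boolP (G \subset K)) => [sGK|].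
  apply: irrG => //; apply/mxmoduleP=> x Gx.
  exact: (mxmoduleP modU) (subsetP sGK x Gx).
case/subsetPn=> t Gt nKt.
have GKt : t \in G :\: K by rewrite inE nKt.
have stabU k : k \in K -> (U *m rG k <= U)%MS by move/(mxmoduleP modU).
have inGK x : x \in G -> x \notin K -> x \in G :\: K by rewrite inE => -> ->.
have Ut2 x : x \in G -> x \notin K -> (U *m rG t *m rG x <= U)%MS.
  by move=> Gx nKx; rewrite -mulmxA -repr_mxM // stabU ?mulGK ?inGK.
have Ut1 x : x \in G -> x \notin K -> (U *m rG x <= U *m rG t)%MS.
  move=> Gx nKx; rewrite -[x](mulgKV t) repr_mxM ?groupM ?groupV // mulmxA submxMr //.
  by rewrite stabU // mulGK ?inGK ?groupV.
have Ut3 k : k \in K -> (U *m rG t *m rG k <= U *m rG t)%MS.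
  move=> Kk; rewrite -mulmxA -repr_mxM ?(subsetP sKG k Kk) // Ut1 //.
    by rewrite groupM ?(subsetP sKG k Kk).
  by rewrite groupMr.
have modS : mxmodule rG (U + U *m rG t)%MS.
  apply/mxmoduleP=> x Gx; rewrite addsmxMr addsmx_sub.
  case: (boolP (x \in K)) => Kx.
    by rewrite (submx_trans (stabU x Kx)) ?addsmxSl //=
               (submx_trans (Ut3 x Kx)) ?addsmxSr.
  by rewrite (submx_trans (Ut1 x Gx Kx)) ?addsmxSr //=
             (submx_trans (Ut2 x Gx Kx)) ?addsmxSl.
have modI : mxmodule rG (U :&: U *m rG t)%MS.
  apply/mxmoduleP=> x Gx; rewrite (submx_trans (capmxMr _ _ _)) // sub_capmx.
  case: (boolP (x \in K)) => Kx.
    by rewrite (submx_trans (capmxSl _ _)) ?stabU //=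
               (submx_trans (capmxSr _ _)) ?Ut3.
  by rewrite (submx_trans (capmxSr _ _)) ?Ut2 //=
             (submx_trans (capmxSl _ _)) ?Ut1.
have rkUt : \rank (U *m rG t) = \rank U.
  by rewrite mxrankMfree // row_free_unit repr_mx_unit.
have fullS : row_full (U + U *m rG t)%MS.
  apply: irrG => //; apply: contraNneq nzU => S0.
  by rewrite -submx0 -S0 addsmxSl.
case: (eqVneq (U :&: U *m rG t)%MS 0) => [I0 | nzI].
  have := mxrank_sum_cap U (U *m rG t); rewrite I0 mxrank0 addn0 rkUt addnn.
  by rewrite (eqnP fullS) => En; rewrite En odd_double in odd_n.
have fullI := irrG _ modI nzI.
by rewrite -sub1mx (submx_trans _ (capmxSl U (U *m rG t))) ?sub1mx.
Qed.

(** Commuting matrices over an algebraically closed field have a common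
eigenvector. *)
Lemma abelian_irr_dim1 (C : numClosedFieldType) (gT : finGroupType)
    (H : {group gT}) n (rH : mx_representation C H n) :
  abelian H -> mx_irreducible rH -> n = 1%N.
Proof.
move=> /centsP cH /mx_irrP[n_gt0 irrH].
pose As := [seq rH x | x in H].
have cAs : {in As &, forall A B, comm_mx A B}.
  move=> _ _ /imageP[x Hx ->] /imageP[y Hy ->]; rewrite /comm_mx.
  by rewrite -!repr_mxM // cH.
have [v nzv stabv] := common_eigenvector n_gt0 cAs.
have modv : mxmodule rH <<v>>%MS.
  apply/mxmoduleP=> x Hx; rewrite (eqmxMr _ (genmxE v)) genmxE.
  by apply: (allP stabv); apply: image_f.
have /eqnP : row_full <<v>>%MS.
  by apply: irrH => //; rewrite -mxrank_eq0 genmxE mxrank_eq0.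
by rewrite genmxE rank_rV nzv => <-.
Qed.

(** By complete reducibility a proper nonzero submodule comes with a
complement, and one of the two has dimension 1 since 3 = 1 + 2. *)
Lemma reducible3_eigenvector (F : fieldType) (gT : finGroupType)
    (G : {group gT}) (rG : mx_representation F G 3) :
  ([pchar F]^'.-group G)%g -> ~ mx_irreducible rG ->
  exists2 v : 'rV_3, v != 0 & {in G, forall x, exists a, v *m rG x = a *: v}.
Proof.
move=> coG redG; apply: contra_notP redG => noline; apply/mx_irrP; split=> // U.
have norank1 (W : 'M_3) : mxmodule rG W -> \rank W != 1%N.
  move=> modW; apply/eqP=> rkW.
  have [u [a Wu ua]] := mxmodule_eigenvector modW rkW.
  apply: noline; exists u => [|x Gx]; last by exists (a x); apply: ua.
  by rewrite -mxrank_eq0 -Wu rkW.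
move=> modU nzU; have [W modW sumUW /mxdirectP dxUW] :=
  mx_Maschke_pchar rG coG modU (submx1 U).
have := norank1 U modU; have := norank1 W modW; move: nzU.
have:= dxUW; rewrite /= sumUW mxrank1 -mxrank_eq0 /row_full.
by case: (\rank U) => [|[|[|[|u]]]] // -[]; case: (\rank W) => [|[]].
Qed.

(** * Explicit coordinates in dimensions 3 and 4 *)

Local Notation "''o3_' k" := (@Ordinal 3 k isT)
  (at level 8, k at level 2, format "''o3_' k").
Local Notation "''o_' k" := (@Ordinal 4 k isT)
  (at level 8, k at level 2, format "''o_' k").

Lemma ord4_ind (P : 'I_4 -> Prop) :
  P 'o_0 -> P 'o_1 -> P 'o_2 -> P 'o_3 -> forall i, P i.
Proof.
move=> P0 P1 P2 P3 [i lti].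
by case: i lti => [|[|[|[|//]]]] lti; rewrite (bool_irrelevance lti isT).
Qed.

Lemma ord3_ind (P : 'I_3 -> Prop) :
  P 'o3_0 -> P 'o3_1 -> P 'o3_2 -> forall i, P i.
Proof.
move=> P0 P1 P2 [i lti].
by case: i lti => [|[|[|//]]] lti; rewrite (bool_irrelevance lti isT).
Qed.

Lemma sum4E (V : nmodType) (F : 'I_4 -> V) :
  \sum_i F i = F 'o_0 + F 'o_1 + F 'o_2 + F 'o_3.
Proof.
rewrite !big_ord_recl big_ord0 addr0 ?addrA /=.
by do 3?[congr (_ + _)]; congr (F _); apply: val_inj.
Qed.

Lemma sum3E (V : nmodType) (F : 'I_3 -> V) :
  \sum_i F i = F 'o3_0 + F 'o3_1 + F 'o3_2.
Proof.
rewrite !big_ord_recl big_ord0 addr0 ?addrA /=.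
by do 2?[congr (_ + _)]; congr (F _); apply: val_inj.
Qed.

Lemma mul4E (R : pzSemiRingType) m n (A : 'M[R]_(m, 4)) (B : 'M_(4, n)) i j :
  (A *m B) i j = A i 'o_0 * B 'o_0 j + A i 'o_1 * B 'o_1 j
               + A i 'o_2 * B 'o_2 j + A i 'o_3 * B 'o_3 j.
Proof. by rewrite mxE sum4E. Qed.

(** * The two quaternion algebras inside the 4 x 4 matrices *)

Section Isoclinic.
Variable R : realFieldType.
Implicit Types (x y : 'rV[R]_3) (b : bool) (M : 'M[R]_4).

(** Identifying a row vector with the quaternion q of the same coordinates,
this is the matrix of q |-> x q for b = false and of q |-> q x for b = true,
where x is the imaginary quaternion with coordinates x. *)
Definition isoclinic b x : 'M[R]_4 :=
  let s := (-1) ^+ b in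
  let x0 := x 0 'o3_0 in let x1 := x 0 'o3_1 in let x2 := x 0 'o3_2 in
  \matrix_(i, j) nth 0 (nth [::]
   [:: [:: 0; x0; x1; x2];
       [:: - x0; 0; s * x2; - (s * x1)];
       [:: - x1; - (s * x2); 0; s * x0];
       [:: - x2; s * x1; - (s * x0); 0]] i) j.

Definition dotv x y : R := (x *m y^T) 0 0.

Definition isocoord M : 'rV[R]_3 := \row_j M 'o_0 (lift ord0 j).

Definition pfaffian4 M : R :=
  M 'o_0 'o_1 * M 'o_2 'o_3 - M 'o_0 'o_2 * M 'o_1 'o_3
  + M 'o_0 'o_3 * M 'o_1 'o_2.

Ltac mx4 :=
  apply/matrixP; elim/ord4_ind; elim/ord4_ind; rewrite ?(mul4E, mxE) /=.

Lemma isoclinic_is_linear b : linear (isoclinic b).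
Proof. by move=> a x y; case: b; mx4; ring. Qed.
HB.instance Definition _ b :=
  GRing.isLinear.Build R 'rV_3 'M_4 *:%R (isoclinic b) (isoclinic_is_linear b).

Lemma lift_o3 :
  (lift (@ord0 3) 'o3_0 = 'o_1) * (lift (@ord0 3) 'o3_1 = 'o_2)
  * (lift (@ord0 3) 'o3_2 = 'o_3).
Proof. by do ![split]; apply: val_inj. Qed.

Lemma isocoordK b : cancel (isoclinic b) isocoord.
Proof.
move=> x; apply/rowP; elim/ord3_ind; rewrite !mxE ?lift_o3 /=; congr (x _ _);
exact: val_inj.
Qed.

Definition crossv x y : 'rV[R]_3 := \row_j
   [:: x 0 'o3_1 * y 0 'o3_2 - x 0 'o3_2 * y 0 'o3_1;
       x 0 'o3_2 * y 0 'o3_0 - x 0 'o3_0 * y 0 'o3_2;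
       x 0 'o3_0 * y 0 'o3_1 - x 0 'o3_1 * y 0 'o3_0]`_j.

(** The quaternion multiplication rule; the order of the factors in the cross
product is reversed when b is false, as left multiplications compose from right
to left. *)
Lemma isoclinicM b x y : isoclinic b x *m isoclinic b y =
  - (-1) ^+ b *: isoclinic b (crossv x y) - (dotv x y)%:M.
Proof. rewrite /dotv mxE sum3E; case: b; mx4; ring. Qed.

(** Left multiplications commute with right multiplications. *)
Lemma isoclinicMC b c x y : b != c ->
  isoclinic b x *m isoclinic c y = isoclinic c y *m isoclinic b x.
Proof. by case: b; case: c => // _; mx4; ring. Qed.

Lemma isoclinic_tr b x : (isoclinic b x)^T = - isoclinic b x.
Proof. by case: b; mx4; ring. Qed.

(** Congruence acts on skew-symmetric matrices through the 2 x 2 minors. *)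
Lemma congr_isoclinicE M b x i j :
  let p k l := M k i * M l j - M l i * M k j in let s := (-1) ^+ b in
  (M^T *m isoclinic b x *m M) i j =
      x 0 'o3_0 * (p 'o_0 'o_1 + s * p 'o_2 'o_3)
    + x 0 'o3_1 * (p 'o_0 'o_2 - s * p 'o_1 'o_3)
    + x 0 'o3_2 * (p 'o_0 'o_3 + s * p 'o_1 'o_2).
Proof. by rewrite !mul4E !mxE /=; case: b; ring. Qed.

Lemma det4E M :
  \det M =
    M 'o_0 'o_0 * (M 'o_1 'o_1 * (M 'o_2 'o_2 * M 'o_3 'o_3 - M 'o_2 'o_3 * M 'o_3 'o_2)
                 - M 'o_1 'o_2 * (M 'o_2 'o_1 * M 'o_3 'o_3 - M 'o_2 'o_3 * M 'o_3 'o_1)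
                 + M 'o_1 'o_3 * (M 'o_2 'o_1 * M 'o_3 'o_2 - M 'o_2 'o_2 * M 'o_3 'o_1))
  - M 'o_0 'o_1 * (M 'o_1 'o_0 * (M 'o_2 'o_2 * M 'o_3 'o_3 - M 'o_2 'o_3 * M 'o_3 'o_2)
                 - M 'o_1 'o_2 * (M 'o_2 'o_0 * M 'o_3 'o_3 - M 'o_2 'o_3 * M 'o_3 'o_0)
                 + M 'o_1 'o_3 * (M 'o_2 'o_0 * M 'o_3 'o_2 - M 'o_2 'o_2 * M 'o_3 'o_0))
  + M 'o_0 'o_2 * (M 'o_1 'o_0 * (M 'o_2 'o_1 * M 'o_3 'o_3 - M 'o_2 'o_3 * M 'o_3 'o_1)
                 - M 'o_1 'o_1 * (M 'o_2 'o_0 * M 'o_3 'o_3 - M 'o_2 'o_3 * M 'o_3 'o_0)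
                 + M 'o_1 'o_3 * (M 'o_2 'o_0 * M 'o_3 'o_1 - M 'o_2 'o_1 * M 'o_3 'o_0))
  - M 'o_0 'o_3 * (M 'o_1 'o_0 * (M 'o_2 'o_1 * M 'o_3 'o_2 - M 'o_2 'o_2 * M 'o_3 'o_1)
                 - M 'o_1 'o_1 * (M 'o_2 'o_0 * M 'o_3 'o_2 - M 'o_2 'o_2 * M 'o_3 'o_0)
                 + M 'o_1 'o_2 * (M 'o_2 'o_0 * M 'o_3 'o_1 - M 'o_2 'o_1 * M 'o_3 'o_0)).
Proof.
(* Entries indexed by nat make the nested lifts of the expansion compute. *)
pose m i j := M (inord i) (inord j).
have -> : M = \matrix_(i, j) m i j.
  by apply/matrixP=> i j; rewrite mxE /m !inord_val.
do 3?rewrite !(expand_det_row _ ord0) !(big_ord_recl, big_ord0) /cofactor.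
rewrite !det_mx11 !mxE /= /bump /=; clearbody m; ring.
Qed.

Lemma pfaffian4_congr M x b :
  pfaffian4 (M^T *m isoclinic b x *m M) = \det M * pfaffian4 (isoclinic b x).
Proof.
by rewrite /pfaffian4 det4E !congr_isoclinicE !mxE /=; case: b; ring.
Qed.

(** A skew-symmetric matrix with entries p_ij lies in one of the two spaces of
isoclinic matrices exactly when (p23, p13, p12) = s (p01, - p02, p03) with s the
corresponding sign. The sum of the squares of the three differences is half the
squared Frobenius norm minus twice s times the Pfaffian. *)
Lemma isoclinic_selfdual b M :
  M^T = - M -> \tr (M *m M^T) = (-1) ^+ b * pfaffian4 M *+ 4 ->
  M = isoclinic b (isocoord M).
Proof.
move=> skewM.
have N i j : M j i = - M i j by have /matrixP/(_ i j) := skewM; rewrite !mxE.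
have D i : M i i = 0.
  by have /eqP := N i i; rewrite -addr_eq0 -mulr2n mulrn_eq0 => /eqP.
rewrite /mxtrace !sum4E !mul4E !mxE !D !(N 'o_0 'o_1, N 'o_0 'o_2, N 'o_0 'o_3).
rewrite !(N 'o_1 'o_2, N 'o_1 'o_3, N 'o_2 'o_3).
rewrite /pfaffian4 => E.
pose s : R := (-1) ^+ b.
have ss : s * s = 1 by rewrite /s -expr2 sqrr_sign.
have := E; set p01 := M 'o_0 'o_1; set p02 := M 'o_0 'o_2.
set p03 := M 'o_0 'o_3; set p12 := M 'o_1 'o_2; set p13 := M 'o_1 'o_3.
set p23 := M 'o_2 'o_3; rewrite -/s => E'.
have : (p23 - s * p01) ^+ 2 + (p13 + s * p02) ^+ 2 + (p12 - s * p03) ^+ 2 = 0.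
  transitivity (2^-1 * (2 * (p01 ^+ 2 + p02 ^+ 2 + p03 ^+ 2
                             + p12 ^+ 2 + p13 ^+ 2 + p23 ^+ 2)
    - 4 * (s * (p01 * p23 - p02 * p13 + p03 * p12)))
    + (s * s - 1) * (p01 ^+ 2 + p02 ^+ 2 + p03 ^+ 2)); first by field.
  by rewrite ss subrr mul0r addr0 [in X in _ - X]mulr_natl -E'; field.
move/eqP; rewrite !paddr_eq0 ?addr_ge0 ?sqr_ge0 // !sqrf_eq0 !subr_eq0 addr_eq0.
case/andP=> /andP[/eqP E23 /eqP E13] /eqP E12.
apply/matrixP; elim/ord4_ind; elim/ord4_ind; rewrite !mxE /= ?lift_o3 ?D //
  ?[LHS]N -/s ?[M 'o_1 'o_2]E12 ?[M 'o_1 'o_3]E13 ?[M 'o_2 'o_3]E23 ?opprK //.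
Qed.

(** The squared norm and the Pfaffian of a skew-symmetric matrix are both
preserved by conjugation by SO(4), the first by orthogonality and the second
because the determinant is 1; by [isoclinic_selfdual] they detect isoclinic
matrices. A reflection would exchange the two spaces. *)
Lemma conj_isoclinic b M x : special_orthogonal M ->
  M^T *m isoclinic b x *m M = isoclinic b (isocoord (M^T *m isoclinic b x *m M)).
Proof.
case/andP=> /eqP oM /eqP dM; apply: isoclinic_selfdual.
  by rewrite !trmx_mul trmxK isoclinic_tr mulNmx mulmxN mulmxA.
rewrite pfaffian4_congr dM mul1r !trmx_mul trmxK -!mulmxA (mulmxA M) oM mul1mx.
rewrite mxtrace_mulC -!mulmxA oM mulmx1 mxtrace_mulC.
rewrite /pfaffian4 /mxtrace !sum4E !mul4E !mxE /=; case: b; ring.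
Qed.

Lemma crossvC x y : crossv y x = - crossv x y.
Proof. by apply/rowP; elim/ord3_ind; rewrite !mxE /=; ring. Qed.

Lemma dotvC x y : dotv y x = dotv x y.
Proof. by rewrite /dotv !mxE; apply: eq_bigr => i _; rewrite !mxE mulrC. Qed.

Lemma dotv_eq0 x : (dotv x x == 0) = (x == 0).
Proof.
rewrite /dotv mxE psumr_eq0 => [|i _]; last by rewrite mxE -expr2 sqr_ge0.
apply/allP/eqP=> [x0 | -> i _]; last by rewrite !mxE mul0r eqxx.
apply/rowP=> i; apply/eqP; have := x0 i (mem_index_enum i).
by rewrite !mxE mulf_eq0 orbb.
Qed.

Lemma isoclinic_sqr b x : isoclinic b x *m isoclinic b x = - (dotv x x)%:M.
Proof.
rewrite isoclinicM; suff -> : crossv x x = 0 by rewrite linear0 scaler0 add0r.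
by apply/rowP; elim/ord3_ind; rewrite !mxE /=; ring.
Qed.

Lemma isoclinic_anticomm b x y : isoclinic b x *m isoclinic b y =
  - (isoclinic b y *m isoclinic b x) - (dotv x y *+ 2)%:M.
Proof.
rewrite !isoclinicM (crossvC x y) (dotvC x y) linearN scalerN opprB.
by rewrite opprK mulr2n raddfD /= opprD addrA [_%:M + _]addrC addrK.
Qed.

Lemma isoclinic_commutator b x y : exists z,
  isoclinic b x *m isoclinic b y - isoclinic b y *m isoclinic b x
    = isoclinic b z.
Proof.
exists ((- (-1) ^+ b *: crossv x y) *+ 2).
rewrite !isoclinicM (crossvC x y) (dotvC x y) linearN scalerN.
by rewrite opprB addrA subrK opprK -mulr2n raddfMn /= linearZ.
Qed.

(** If X and Y commute then XY is the scalar - (x . y), and multiplying by X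
gives |x|^2 Y = (x . y) X. *)
Lemma isoclinic_comm_parallel b x y : x != 0 ->
  isoclinic b x *m isoclinic b y = isoclinic b y *m isoclinic b x ->
  y = (dotv x y / dotv x x) *: x.
Proof.
rewrite -dotv_eq0 => nzx cxy; apply: (can_inj (isocoordK b)).
have xy : isoclinic b x *m isoclinic b y = - (dotv x y)%:M.
  have := isoclinic_anticomm b x y; rewrite -cxy => /(congr1 (+%R _)).
  move/(_ (isoclinic b x *m isoclinic b y)).
  rewrite addrA subrr sub0r -mulr2n raddfMn -mulNrn -!scaler_nat.
  by apply: scalerI; rewrite pnatr_eq0.
apply: (scalerI nzx); rewrite linearZ scalerA mulrCA divff // mulr1.
have := congr1 (mulmx (isoclinic b x)) xy.
rewrite mulmxA isoclinic_sqr !mulNmx mulmxN mul_scalar_mx mul_mx_scalar.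
by move/oppr_inj.
Qed.

Lemma isocoord_is_linear : linear isocoord.
Proof. by move=> a M N; apply/rowP=> j; rewrite !mxE. Qed.
HB.instance Definition _ :=
  GRing.isLinear.Build R 'M_4 'rV_3 *:%R isocoord isocoord_is_linear.

(** Representations act on row vectors from the right, so conjugation is taken
in the form X |-> M^T X M, which is multiplicative in M in that order. *)
Definition iso_rot b M : 'M[R]_3 :=
  lin1_mx (isocoord \o mulmxr M \o mulmx M^T \o isoclinic b).

Lemma iso_rotE b M x : special_orthogonal M ->
  isoclinic b (x *m iso_rot b M) = M^T *m isoclinic b x *m M.
Proof. by move=> soM; rewrite mul_rV_lin1 /= -conj_isoclinic. Qed.

Lemma iso_rot1 b : iso_rot b 1%:M = 1%:M.
Proof.
apply/row_matrixP=> i; rewrite !rowE mulmx1.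
apply: (can_inj (isocoordK b)).
by rewrite iso_rotE ?special_orthogonal1 // trmx1 mul1mx mulmx1.
Qed.

Lemma iso_rotM b M N : special_orthogonal M -> special_orthogonal N ->
  iso_rot b (M *m N) = iso_rot b M *m iso_rot b N.
Proof.
move=> soM soN; apply/row_matrixP=> i; rewrite !rowE mulmxA.
apply: (can_inj (isocoordK b)).
by rewrite !iso_rotE ?special_orthogonalM // trmx_mul !mulmxA.
Qed.

(** Conjugation by M multiplies X by c and fixes the scalar X^2, so c^2 = 1. *)
Lemma isoclinic_sign b M x c : special_orthogonal M -> x != 0 ->
  x *m iso_rot b M = c *: x ->
  isoclinic b x *m M = M *m isoclinic b x \/
  isoclinic b x *m M = - (M *m isoclinic b x).
Proof.
move=> soM; rewrite -dotv_eq0 => nzx xc.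
have := iso_rotE b x soM; rewrite xc linearZ /= => cX.
have /andP[/eqP oM _] := soM.
have XM : isoclinic b x *m M = c *: (M *m isoclinic b x).
  by rewrite scalemxAr cX !mulmxA oM mul1mx.
have: c ^+ 2 == 1.
  apply/eqP/(mulIf nzx)/oppr_inj; rewrite mul1r.
  have : isoclinic b x *m (isoclinic b x *m M) =
         c ^+ 2 *: (M *m (isoclinic b x *m isoclinic b x)).
    by rewrite XM -scalemxAr !mulmxA XM -!scalemxAl scalerA.
  rewrite mulmxA isoclinic_sqr -raddfN /= mul_scalar_mx mul_mx_scalar scalerA.
  move/(congr1 (mulmx^~ M^T)); rewrite -!scalemxAl oM !scalemx1.
  by move/(congr1 (fun A : 'M_4 => A 0 0)); rewrite !mxE !mulr1n mulrN => <-.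
rewrite sqrf_eq1 => /orP[]/eqP c1; [left|right].
  by rewrite XM c1 scale1r.
by rewrite XM c1 scaleN1r.
Qed.

(** * The centralizer of a pair of imaginary quaternions *)

(** With E_k running over the imaginary units of the algebra b, this is the sum
of u M u^-1 over the four units u = 1, E_1, E_2, E_3: up to a factor 4, the
projection of M onto the commutant of that algebra. *)
Definition casimir b M : 'M[R]_4 :=
  M - \sum_k isoclinic b (delta_mx 0 k) *m M *m isoclinic b (delta_mx 0 k).

Lemma isoclinic_delta b x :
  isoclinic b x = \sum_k x 0 k *: isoclinic b (delta_mx 0 k).
Proof.
rewrite {1}[x]row_sum_delta linear_sum; apply: eq_bigr => k _.
by rewrite linearZ.
Qed.

Lemma dotv_delta x k : dotv x (delta_mx 0 k) = x 0 k.
Proof. by rewrite /dotv trmx_delta -colE mxE. Qed.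

Lemma crossv_delta x k l :
  crossv x (delta_mx 0 k) 0 l = - crossv x (delta_mx 0 l) 0 k.
Proof. by elim/ord3_ind: k; elim/ord3_ind: l; rewrite !mxE /=; ring. Qed.

(** Expanding X E_k and E_k X by the multiplication rule, the scalar parts
contribute M X and X M, and the vector parts agree because the coordinates of
the cross product with x form a skew-symmetric matrix. *)
Lemma casimir_comm b M x : comm_mx (isoclinic b x) (casimir b M).
Proof.
rewrite /comm_mx /casimir mulmxBr mulmxBl !(mulmx_sumr, mulmx_suml).
pose E (k : 'I_3) : 'M[R]_4 := isoclinic b (delta_mx 0 k).
pose s : R := - (-1) ^+ b.
have El k : isoclinic b x *m E k =
   s *: isoclinic b (crossv x (delta_mx 0 k)) - (x 0 k)%:M.
  rewrite /E /s isoclinicM dotv_delta; exact: erefl.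
have Er k : E k *m isoclinic b x =
   - s *: isoclinic b (crossv x (delta_mx 0 k)) - (x 0 k)%:M.
  rewrite /E /s isoclinicM dotvC dotv_delta crossvC linearN scalerN.
  rewrite [in RHS]scaleNr.
  exact: erefl.
have suml : \sum_k isoclinic b x *m (E k *m M *m E k) =
  s *: (\sum_k isoclinic b (crossv x (delta_mx 0 k)) *m M *m E k)
    - M *m isoclinic b x.
  rewrite [isoclinic b x in RHS]isoclinic_delta mulmx_sumr scaler_sumr -sumrB.
  apply: eq_bigr => k _; rewrite !mulmxA El mulmxBl mulmxBl.
  by rewrite !mul_scalar_mx -!scalemxAl -scalemxAr.
have sumr : \sum_k E k *m M *m E k *m isoclinic b x =
  - s *: (\sum_k E k *m M *m isoclinic b (crossv x (delta_mx 0 k)))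
    - isoclinic b x *m M.
  rewrite [isoclinic b x in RHS]isoclinic_delta mulmx_suml scaler_sumr -sumrB.
  apply: eq_bigr => k _; rewrite -mulmxA Er mulmxBr.
  by rewrite !mul_mx_scalar -!scalemxAl -scalemxAr.
have anti : \sum_k isoclinic b (crossv x (delta_mx 0 k)) *m M *m E k =
          - \sum_k E k *m M *m isoclinic b (crossv x (delta_mx 0 k)).
  transitivity (\sum_k \sum_l
      crossv x (delta_mx 0 k) 0 l *: (E l *m M *m E k)).
    apply: eq_bigr => k _; rewrite isoclinic_delta !mulmx_suml.
    by apply: eq_bigr => l _; rewrite -!scalemxAl.
  rewrite exchange_big -sumrN; apply: eq_bigr => k _.
  rewrite [in RHS]isoclinic_delta mulmx_sumr -sumrN; apply: eq_bigr => l _.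
  by rewrite crossv_delta scaleNr -scalemxAr.
rewrite suml sumr anti scalerN scaleNr !opprD !opprK.
by rewrite [LHS]addrC [RHS]addrCA -addrA.
Qed.

(** The commutant of one quaternion algebra is the other one. Such an M is
determined by its first row: the unit E_k sends the first basis row vector to
the next ones, so the other rows of M are the images of the first under E_k. *)
Lemma commutant_isoclinic b M : (forall x, comm_mx (isoclinic b x) M) ->
  M = (M 'o_0 'o_0)%:M + isoclinic (~~ b) (isocoord M).
Proof.
move=> cM.
have row1 k j : (isoclinic b (delta_mx 0 k) *m M) 'o_0 j =
                (M *m isoclinic b (delta_mx 0 k)) 'o_0 j by rewrite cM.
apply/matrixP; elim/ord4_ind => j;
  [|have := row1 'o3_0 j|have := row1 'o3_1 j|have := row1 'o3_2 j].
all: case: b {cM row1}; elim/ord4_ind: j; rewrite ?(mul4E, mxE) /= ?lift_o3.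
1-8: ring.
all: move/eqP; rewrite -subr_eq0 => /eqP H.
all: apply/eqP; rewrite -subr_eq0; apply/eqP; rewrite -[RHS]H; ring.
Qed.

(** The centralizer of X is the module spanned by 1 and X over the commutant of
the algebra b; this formula computes the two coefficients. It comes from
X E_k = - E_k X - 2 x_k. *)
Lemma casimir_decomposition b x M : comm_mx (isoclinic b x) M ->
  (dotv x x *+ 4) *: M =
    dotv x x *: casimir b M - isoclinic b x *m casimir b (isoclinic b x *m M).
Proof.
move=> cXM; rewrite /casimir; set X := isoclinic b x in cXM *; set d := dotv x x.
set S := \sum_k _ *m M *m _.
have XX : X *m X = - d%:M by apply: isoclinic_sqr.
have sumX : X *m (\sum_k isoclinic b (delta_mx 0 k) *m (X *m M) *m
                        isoclinic b (delta_mx 0 k)) = d *: S + (d *+ 2) *: M.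
  have -> : (d *+ 2) *: M = \sum_k
      - (X *m M *m (x 0 k *: isoclinic b (delta_mx 0 k))) *+ 2.
    rewrite sumrMnl sumrN -mulmx_sumr -isoclinic_delta.
    by rewrite -mulmxA -cXM mulmxA XX mulNmx mul_scalar_mx opprK scalerMnl.
  rewrite mulmx_sumr scaler_sumr -big_split.
  apply: eq_bigr => k _ /=.
  rewrite !mulmxA isoclinic_anticomm dotv_delta !mulmxBl !mulNmx -!mulmxA.
  rewrite mul_scalar_mx -/X (mulmxA X X) XX mulNmx mul_scalar_mx mulmxN.
  by rewrite opprK -!scalemxAr mulNrn scalerMnl.
rewrite mulmxBr sumX mulmxA XX mulNmx mul_scalar_mx scalerBr.
rewrite opprD !opprK addrACA addKr -!scalerDl.
by congr (_ *: _); rewrite !mulrS mulr0n addr0 !addrA.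
Qed.

(** The projection lies in the other quaternion algebra and still commutes
with Y, so its imaginary part is parallel to Y. *)
Lemma casimir_commutant b y M : y != 0 -> comm_mx (isoclinic (~~ b) y) M ->
  exists a t, casimir b M = a%:M + t *: isoclinic (~~ b) y.
Proof.
move=> nzy cYM; have D := commutant_isoclinic (casimir_comm b M).
set w := isocoord _ in D; set a := _ 'o_0 'o_0 in D.
have cY x : comm_mx (isoclinic (~~ b) y) (isoclinic b x).
  by apply: isoclinicMC; case: (b).
have cYC : comm_mx (isoclinic (~~ b) y) (casimir b M).
  apply: comm_mxB => //; apply: comm_mx_sum => k _.
  by do ![apply: comm_mxM].
have /(isoclinic_comm_parallel nzy) wy :
    comm_mx (isoclinic (~~ b) y) (isoclinic (~~ b) w).
  have -> : isoclinic (~~ b) w = casimir b M - a%:M by rewrite D addrC addKr.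
  by apply: comm_mxB => //; apply/comm_mx_sym/comm_scalar_mx.
by exists a, (dotv y w / dotv y y); rewrite -linearZ /= -wy.
Qed.

(** By the two previous results M is a polynomial in X and Y, so it commutes
with everything that commutes with X and Y. *)
Lemma centralizer_isoclinic_pair b x y M N : x != 0 -> y != 0 ->
  comm_mx (isoclinic b x) M -> comm_mx (isoclinic (~~ b) y) M ->
  comm_mx (isoclinic b x) N -> comm_mx (isoclinic (~~ b) y) N ->
  comm_mx M N.
Proof.
rewrite -dotv_eq0 => nzx nzy cXM cYM cXN cYN.
have cC P : comm_mx (isoclinic (~~ b) y) P -> comm_mx N (casimir b P).
  move=> /(casimir_commutant nzy)[a [t ->]].
  apply: comm_mxD; first exact/comm_mx_sym/comm_scalar_mx.
  by rewrite /comm_mx -scalemxAl -scalemxAr cYN.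
apply/comm_mx_sym; rewrite /comm_mx.
have nz4 : dotv x x *+ 4 != 0 by rewrite mulrn_eq0.
apply: (scalerI nz4).
rewrite scalemxAr [RHS]scalemxAl (casimir_decomposition cXM).
apply: comm_mxB.
  by rewrite /comm_mx -scalemxAl -scalemxAr cC.
apply: comm_mxM; first exact/comm_mx_sym.
apply: cC; apply: comm_mxM => //; apply: isoclinicMC; by case: (b).
Qed.
End Isoclinic.

(** * The two representations of degree 3 of a finite subgroup of SO(4) *)

Lemma real_mx_complex_eigenvector (R : rcfType) n (A : 'M[R]_n)
    (v : 'rV[R[i]]_n) (p q : R) :
  let x := map_mx (@complex.Re R) v in let y := map_mx (@complex.Im R) v in
  v *m map_mx (real_complex R) A = (p +i* q)%C *: v ->
  x *m A = p *: x - q *: y /\ y *m A = q *: x + p *: y.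
Proof.
move=> x y /rowP vA.
have ReD : {morph @complex.Re R : a b / a + b} by case=> ? ? [].
have ImD : {morph @complex.Im R : a b / a + b} by case=> ? ? [].
split; apply/rowP=> j; have := vA j; rewrite !mxE.
  move/(congr1 (@complex.Re R)); rewrite (big_morph _ ReD (erefl _)).
  case: (v 0 j) => a c /= <-; apply: eq_bigr => k _; rewrite !mxE.
  by case: (v 0 k) => ? ? /=; rewrite mulr0 subr0.
move/(congr1 (@complex.Im R)); rewrite (big_morph _ ImD (erefl _)).
case: (v 0 j) => a c /=; rewrite addrC => <-; apply: eq_bigr => k _; rewrite !mxE.
by case: (v 0 k) => ? ? /=; rewrite mulr0 add0r.
Qed.

Section FiniteSubgroup.
Variables (R : realType) (G : finSubgroup (SO R 4)).

Definition fsg_mx (g : fsg_type G) : 'M[R]_4 := SO_val (val g).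

Lemma fsg_mxP g : special_orthogonal (fsg_mx g).
Proof. exact: SO_valP. Qed.

Lemma fsg_mx1 : fsg_mx 1%g = 1%:M.
Proof. by []. Qed.

Lemma fsg_mxM g h : fsg_mx (g * h)%g = fsg_mx g *m fsg_mx h.
Proof. by []. Qed.

Lemma fsg_mx_inj : injective fsg_mx.
Proof. by move=> g h /val_inj/val_inj. Qed.

Lemma iso_rot_is_repr b : mx_repr (fsg_group G) (fun g => iso_rot b (fsg_mx g)).
Proof.
split=> [|g h _ _]; first by rewrite fsg_mx1 iso_rot1.
by rewrite fsg_mxM iso_rotM ?fsg_mxP.
Qed.

Definition iso_repr b : mx_representation R[i] (fsg_group G) 3 :=
  map_repr (real_complex R) (MxRepresentation (iso_rot_is_repr b)).

(** Let v = x + i y be a complex eigenvector, with eigenvalues l(g), and let X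
and Y be the isoclinic matrices of x and y. The commutator [X, Y] is again
isoclinic, and g multiplies it by |l(g)|^2: it is the required vector if it is
nonzero. Otherwise x and y are parallel and whichever is nonzero spans the
line of v. *)
Lemma reducible_iso_repr_real b : ~ mx_irreducible (iso_repr b) ->
  exists2 x : 'rV[R]_3, x != 0 &
    forall g, exists c, x *m iso_rot b (fsg_mx g) = c *: x.
Proof.
have coG : ([pchar R[i]]^'.-group (fsg_group G))%g.
  by apply/pgroupP=> p p_pr _; rewrite inE /= pchar_num.
move=> /(reducible3_eigenvector coG)[v nzv eigv].
pose x : 'rV[R]_3 := map_mx (@complex.Re R) v.
pose y : 'rV[R]_3 := map_mx (@complex.Im R) v.
have act g : exists p q : R,
    x *m iso_rot b (fsg_mx g) = p *: x - q *: y /\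
    y *m iso_rot b (fsg_mx g) = q *: x + p *: y.
  have [[p q] vg] := eigv g (in_setT g); exists p, q.
  exact: real_mx_complex_eigenvector vg.
pose X := isoclinic b x; pose Y := isoclinic b y.
have [cXY|ncXY] := eqVneq (X *m Y) (Y *m X).
  have [x0|nzx] := eqVneq x 0; last first.
    exists x => // g; have [p [q [-> _]]] := act g.
    rewrite [y](isoclinic_comm_parallel nzx cXY) scalerA -scalerBl.
    by eexists.
  have nzy : y != 0.
    apply: contraNneq nzv => y0; apply/eqP/rowP=> j.
    have /rowP/(_ j) := x0; have /rowP/(_ j) := y0; rewrite !mxE.
    by case: (v 0 j) => ? ? /= -> ->.
  exists y => // g; have [p [q [_ ->]]] := act g.
  by exists p; rewrite x0 scaler0 add0r.
have [z zE] := isoclinic_commutator b x y.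
exists z => [|g].
  apply: contraNneq ncXY => z0; move: zE.
  by rewrite z0 linear0 => /eqP; rewrite subr_eq0.
have [p [q [xg yg]]] := act g; exists (p * p + q * q).
apply: (can_inj (isocoordK b)).
rewrite iso_rotE ?fsg_mxP // linearZ /= -zE -/X -/Y.
have := iso_rotE b x (fsg_mxP g); have := iso_rotE b y (fsg_mxP g).
rewrite xg yg linearD linearB /= !linearZ /= -/X -/Y.
set M := fsg_mx g => yM xM.
have oM : M *m M^T = 1%:M by have /andP[/eqP] := fsg_mxP g.
have conjM A B : M^T *m (A *m B) *m M = (M^T *m A *m M) *m (M^T *m B *m M).
  by rewrite !mulmxA; congr (_ *m _); rewrite -!mulmxA (mulmxA M) oM mul1mx.
rewrite mulmxBr mulmxBl !conjM -xM -yM.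
rewrite !(mulmxDl, mulmxDr) -!scalemxAl -!scalemxAr.
rewrite !(mulmxN, mulNmx).
move: (X *m X) (X *m Y) (Y *m X) (Y *m Y) => XX XY YX YY.
by apply/matrixP=> i j; rewrite !mxE; ring.
Qed.

Lemma reducible_iso_repr_sign b : ~ mx_irreducible (iso_repr b) ->
  exists2 x : 'rV[R]_3, x != 0 & forall g,
    isoclinic b x *m fsg_mx g = fsg_mx g *m isoclinic b x \/
    isoclinic b x *m fsg_mx g = - (fsg_mx g *m isoclinic b x).
Proof.
case/reducible_iso_repr_real=> x nzx xg; exists x => // g.
by have [c xc] := xg g; apply: isoclinic_sign xc => //; apply: fsg_mxP.
Qed.

Definition cent_mx4 (X : 'M[R]_4) : {set fsg_type G} :=
  [set g | X *m fsg_mx g == fsg_mx g *m X].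

Lemma group_set_cent_mx4 X : group_set (cent_mx4 X).
Proof.
apply/group_setP; split=> [|g h]; first by rewrite inE fsg_mx1 mulmx1 mul1mx.
rewrite !inE => /eqP Xg /eqP Xh.
by rewrite fsg_mxM mulmxA Xg -mulmxA Xh mulmxA.
Qed.
Canonical cent_mx4_group X := Group (group_set_cent_mx4 X).

(** Going through the two index 2 steps from G to K and from K to H, rather than
directly from G to H, is what allows [odd_irr_restrict] to apply. *)
Lemma odd_irr_linear n (rho : mx_representation R[i] (fsg_group G) n) :
  (forall b, ~ mx_irreducible (iso_repr b)) ->
  odd n -> mx_irreducible rho -> n = 1%N.
Proof.
move=> red odd_n irr.
have [x nzx Xg] := reducible_iso_repr_sign (red false).
have [y nzy Yg] := reducible_iso_repr_sign (red true).
have sign X : (forall g, X *m fsg_mx g = fsg_mx g *m X \/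
                         X *m fsg_mx g = - (fsg_mx g *m X)) ->
    {in ~: cent_mx4 X &, forall g h, (g * h)%g \in cent_mx4 X}.
  move=> gX g h; rewrite !inE.
  case: (gX g) (gX h) => [-> | Xg'] [-> | Xh']; rewrite ?eqxx // => _ _.
  rewrite fsg_mxM mulmxA Xg' mulNmx -[_ *m X *m _]mulmxA Xh' mulmxN.
  by rewrite opprK mulmxA.
pose K := cent_mx4_group (isoclinic false x).
pose L := cent_mx4_group (isoclinic true y).
have sKG : K \subset fsg_group G by apply: subsetT.
have irrK : mx_irreducible (subg_repr rho sKG).
  apply: odd_irr_restrict => // g h; rewrite !in_setD !in_setT !andbT => nKg nKh.
  by apply: sign; rewrite ?in_setC.
have irrH : mx_irreducible (subg_repr (subg_repr rho sKG) (subsetIl K L)).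
  apply: (@odd_irr_restrict _ _ _ (K :&: L)%G) => // g h.
  rewrite !inE => /andP[+ Kg] /andP[+ Kh]; rewrite Kg Kh /= => nLg nLh.
  have := groupM (_ : g \in K) (_ : h \in K); rewrite !inE => -> //=.
  by have := sign _ Yg g h; rewrite !inE => ->.
apply: abelian_irr_dim1 irrH; apply/centsP=> g Hg h Hh; apply: fsg_mx_inj.
move: Hg Hh; rewrite !inE => /andP[/eqP gX /eqP gY] /andP[/eqP hX /eqP hY].
rewrite !fsg_mxM; exact: (@centralizer_isoclinic_pair _ false x y).
Qed.

End FiniteSubgroup.

Local Close Scope ring_scope.

Theorem theorem12 (R : realType) (G : finSubgroup (SO R 4)) :
  (exists (n : nat) (rho : mx_representation R[i] (fsg_group G) n),
      [/\ mx_irreducible rho, odd n & 1 < n])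
  <->
  (exists rho : mx_representation R[i] (fsg_group G) 3, mx_irreducible rho).
Proof.
split=> [[n [rho [irr odd_n n_gt1]]] | [rho irr]]; last by exists 3, rho.
apply: contrapT => no3.
have n1 : n = 1.
  apply: odd_irr_linear odd_n irr => b irrb.
  by apply: no3; exists (iso_repr G b).
by rewrite n1 in n_gt1.
Qed.
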